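(* Let $(A,\mu)$ be a Lie algebroid, let $\varepsilon_1,\varepsilon_2,\varepsilon_3\in\{1,-1\}$, let $(\omega_1,\omega_2,\omega_3)$ be a triplet of non-degenerate $2$-forms on $A$ with inverse bivectors $(\pi_1,\pi_2,\pi_3)$, and let $k\in\{1,2,3\}$. Then $(\omega_1,\omega_2,\omega_3)$ is an $\boldsymbol{\varepsilon}$-hypersymplectic structure on the Lie algebroid $(A,\mu)$ if and only if $\mu+\mu_{\pi_k}$ is a Courant structure on $A\oplus A^*$ and $(\mathcal{S}_1,\mathcal{S}_2,\mathcal{S}_3)$ is an $\boldsymbol{\varepsilon}$-hypersymplectic structure on the Courant algebroid $(A\oplus A^*,\mu+\mu_{\pi_k})$, where $$\mathcal{S}_i=\begin{pmatrix}0&\varepsilon_i\,\pi_i^{\sharp}\\ \omega_i^{\flat}&0\end{pmatrix}:A\oplus A^*\to A\oplus A^*,\qquad i=1,2,3 .$$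
   Context: $A\to M$ is a real vector bundle; $\mu$ denotes a Lie algebroid structure on $A$ with anchor $\rho_A$, bracket $[\cdot,\cdot]_A$, differential $\mathrm{d}$ and Lie derivative $\mathcal{L}$. For $\omega\in\Gamma(\wedge^2A^* )$ and $\pi\in\Gamma(\wedge^2A)$, $\omega^\flat:A\to A^*$, $\langle\omega^\flat X,Y\rangle=\omega(X,Y)$, and $\pi^\sharp:A^*\to A$, $\langle\beta,\pi^\sharp\alpha\rangle=\pi(\alpha,\beta)$; $\pi$ is the inverse of $\omega$ if $\pi^\sharp\circ\omega^\flat=\mathrm{id}_A$. A symplectic form is a non-degenerate $\mathrm{d}$-closed $2$-form on $A$. Indices are in $\mathbb{Z}_3=\{1,2,3\}$ and $\boldsymbol{\varepsilon}=(\varepsilon_1,\varepsilon_2,\varepsilon_3)$. An $\boldsymbol{\varepsilon}$-hypersymplectic structure on a Lie algebroid $(A,\mu)$ is a triplet $(\omega_1,\omega_2,\omega_3)$ of symplectic forms with inverse (Poisson) bivectors $(\pi_1,\pi_2,\pi_3)$ such that $N_i:=\pi_{i-1}^\sharp\circ\omega_{i+1}^\flat$ satisfies $N_i^2=\varepsilon_i\,\mathrm{id}_A$, $i=1,2,3$. $A\oplus A^*$ carries $\langle X+\alpha,Y+\beta\rangle=\alpha(Y)+\beta(X)$. A pre-Courant structure $\Theta$ on a vector bundle $E$ with a fibrewise non-degenerate symmetric form $\langle\cdot,\cdot\rangle$ is a pair $(\rho,[\cdot,\cdot])$ of an anchor $\rho:E\to TM$ and an $\mathbb{R}$-bilinear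 bracket on $\Gamma(E)$ with $\rho(e)\cdot\langle e',e''\rangle=\langle[e,e'],e''\rangle+\langle e',[e,e'']\rangle=\langle e,[e',e'']+[e'',e']\rangle$; it is a Courant structure if moreover $[e,[e',e'']]=[[e,e'],e'']+[e',[e,e'']]$. Structures are added and multiplied by scalars componentwise (on anchors and brackets). The Lie algebroid $\mu$ defines a Courant structure on $A\oplus A^*$, also denoted $\mu$, with anchor $\rho(X+\alpha)=\rho_A(X)$ and bracket $[X+\alpha,Y+\beta]=[X,Y]_A+\mathcal{L}_X\beta-i_Y\mathrm{d}\alpha$. The deformation of $\Theta=(\rho,[\cdot,\cdot])$ by a bundle endomorphism $\mathcal{I}$ of $E$ is $\Theta_{\mathcal{I}}=(\rho\circ\mathcal{I},[\cdot,\cdot]_{\mathcal{I}})$ with $[e,e']_{\mathcal{I}}=[\mathcal{I}e,e']+[e,\mathcal{I}e']-\mathcal{I}[e,e']$, and $\Theta_{\mathcal{I},\mathcal{J}}=(\Theta_{\mathcal{I}})_{\mathcal{J}}$. For a bivector $\pi$ on $A$, $\mu_\pi$ is the deformation of the structure $\mu$ on $A\oplus A^*$ by the skew-symmetric endomorphism $X+\alpha\mapsto\pi^\sharp\alpha$; when $\pi$ is Poisson, $\mu_\pi$ is the well-known Lie algebroid structure on $A^*$ with anchor $\rho_A\circ\pi^\sharp$ and bracket $[\alpha,\beta]_\pi=\mathcal{L}_{\pi^\sharp\alpha}\beta-\mathcal{L}_{\pi^\sharp\beta}\alpha-\mathrm{d}(\pi(\alpha,\beta))$, and $\mu+\mu_\pi$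 is the double of the triangular Lie bialgebroid $((A,A^* ),\mu,\mu_\pi)$. An $\boldsymbol{\varepsilon}$-hypersymplectic structure on $(E,\Theta)$ is a triplet $(\mathcal{S}_1,\mathcal{S}_2,\mathcal{S}_3)$ of endomorphisms, skew-symmetric with respect to $\langle\cdot,\cdot\rangle$, such that $\mathcal{S}_i^2=\varepsilon_i\,\mathrm{id}_E$; $\mathcal{S}_i\mathcal{S}_j=\varepsilon_1\varepsilon_2\varepsilon_3\,\mathcal{S}_j\mathcal{S}_i$ for $i\neq j$; and $\Theta_{\mathcal{S}_i,\mathcal{S}_i}=\varepsilon_i\Theta$, for $i,j\in\{1,2,3\}$. *)

(* Defs.v *)
From HB Require Import structures.
From mathcomp Require Import all_boot all_order all_algebra.
From mathcomp Require Import all_classical all_reals all_analysis.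
From mathcomp Require Import ring.

Set Implicit Arguments.
Unset Strict Implicit.
Unset Printing Implicit Defensive.

Import Order.TTheory GRing.Theory Num.Theory.
Import numFieldNormedType.Exports.

Local Open Scope classical_set_scope.
Local Open Scope ring_scope.

Section euclidean.
Variables (R : realType) (n : nat).
Implicit Types (U : set 'rV[R]_n) (f g : 'rV[R]_n -> R).

(* Used for open U only: f is k times continuously differentiable on U, in   *)
(* terms of iterated partial derivatives.                                    *)
Fixpoint Ck (k : nat) U f : Prop :=
  (forall x, U x -> {for x, continuous f}) /\
  (if k is k'.+1 then
     forall i : 'I_n, (forall x, U x -> derivable f x (delta_mx 0 i)) /\
                      Ck k' U (fun x => 'D_(delta_mx 0 i) f x)
   else True).

Definition smooth_on U f := forall k, Ck k U f.

Lemma Ck_eq k U f g : open U -> (forall x, U x -> f x = g x) ->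
  Ck k U f -> Ck k U g.
Proof.
move=> oU fg0; have nfg f' g' : (forall x, U x -> f' x = g' x) ->
    forall x, U x -> \forall y \near x, f' y = g' y.
  move=> e x Ux; have := open_nbhs_nbhs (conj oU Ux).
  by apply: filterS => y /e.
have ceq f' g' : (forall x, U x -> f' x = g' x) ->
    (forall x, U x -> {for x, continuous f'}) ->
    forall x, U x -> {for x, continuous g'}.
  move=> e cf x Ux; rewrite /prop_for /continuous_at -(e x Ux).
  exact: cvg_trans (near_eq_cvg (nfg _ _ e x Ux)) (cf x Ux).
elim: k f g fg0 => [|k IH] f g fg [cf df]; split=> //; try exact: ceq cf.
move=> i; have [dfi ckf] := df i; split.
  by move=> x Ux; apply: near_eq_derivable (nfg _ _ fg x Ux) (dfi x Ux).
apply: IH ckf => x Ux.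
by apply: near_eq_derive; exact: nfg fg x Ux.
Qed.

Lemma CkS k U f : Ck k.+1 U f -> Ck k U f.
Proof.
elim: k f => [|k IH] f [cf df]; first by split.
split=> // i; have [dfi ckf] := df i; split=> //; exact: IH.
Qed.

Lemma Ck_cst k U (c : R) : Ck k U (fun=> c).
Proof.
have cc (d : R) x : U x -> {for x, continuous (fun=> d : R)}.
  by move=> _; exact: (@cst_continuous _ _ d).
elim: k c => [|k IH] c.
  by split=> // x; exact: cc.
split; first by move=> x; exact: cc.
move=> i; split; first by move=> x _; exact: derivable_cst.
rewrite (_ : (fun x => 'D__ _ x) = fun=> 0); first exact: IH.
by apply/funext => x; exact: derive_cst.
Qed.

Lemma CkD k U f g : open U -> Ck k U f -> Ck k U g ->
  Ck k U (fun x => f x + g x).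
Proof.
move=> oU; elim: k f g => [|k IH] f g [cf df] [cg dg].
  by split=> // x Ux; exact: (cvgD (cf x Ux) (cg x Ux)).
split; first by move=> x Ux; exact: (cvgD (cf x Ux) (cg x Ux)).
move=> i; have [dfi ckf] := df i; have [dgi ckg] := dg i; split.
  by move=> x Ux; exact: (derivableD (dfi x Ux) (dgi x Ux)).
apply: Ck_eq (IH _ _ ckf ckg) => // x Ux.
exact/esym/(deriveD (dfi x Ux) (dgi x Ux)).
Qed.

Lemma CkM k U f g : open U -> Ck k U f -> Ck k U g ->
  Ck k U (fun x => f x * g x).
Proof.
move=> oU; elim: k f g => [|k IH] f g ckf ckg.
  case: ckf ckg => [cf _] [cg _].
  by split=> // x Ux; exact: (cvgM (cf x Ux) (cg x Ux)).
case: (ckf) (ckg) => [cf df] [cg dg].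
split; first by move=> x Ux; exact: (cvgM (cf x Ux) (cg x Ux)).
move=> i; have [dfi ckfi] := df i; have [dgi ckgi] := dg i; split.
  by move=> x Ux; exact: (derivableM (dfi x Ux) (dgi x Ux)).
apply: Ck_eq (CkD oU (IH _ _ (CkS ckf) ckgi) (IH _ _ (CkS ckg) ckfi)) => //.
by move=> x Ux; exact/esym/(deriveM (dfi x Ux) (dgi x Ux)).
Qed.

End euclidean.

(* [chart_map] and [chart_inv] are total; only their values on [chart_dom]   *)
(* and on its image matter.                                                  *)
Record chart (R : realType) (n : nat) (M : topologicalType) := Chart {
  chart_dom : set M;
  chart_map : M -> 'rV[R]_n;
  chart_inv : 'rV[R]_n -> M;
  chart_dom_open : open chart_dom;
  chart_img_open : open (chart_map @` chart_dom);
  chart_mapK : forall x, chart_dom x -> chart_inv (chart_map x) = x;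
  chart_map_cont : forall x, chart_dom x -> {for x, continuous chart_map};
  chart_inv_cont : forall y, (chart_map @` chart_dom) y ->
    {for y, continuous chart_inv}
}.

Record manifold (R : realType) (n : nat) := Manifold {
  carrier :> topologicalType;
  manifold_hausdorff : hausdorff_space carrier;
  manifold_second_countable : @second_countable carrier;
  atlas : set (chart R n carrier);
  atlas_cover : forall x : carrier, exists2 c, atlas c & chart_dom c x;
  atlas_smooth : forall c c', atlas c -> atlas c' -> forall j : 'I_n,
    smooth_on (chart_map c @` (chart_dom c `&` chart_dom c'))
              (fun y => chart_map c' (chart_inv c y) 0 j)
}.

Section smooth_functions.
Variables (R : realType) (n : nat) (M : manifold R n).

(* Used for open W only. *)
Definition smooth_fun_on (W : set M) (f : M -> R) :=
  forall c, atlas c ->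
    smooth_on (chart_map c @` (chart_dom c `&` W)) (fun y => f (chart_inv c y)).

Lemma chart_img_openI (c : chart R n M) (W : set M) : open W ->
  open (chart_map c @` (chart_dom c `&` W)).
Proof.
move=> oW; rewrite openE => y [x [cx Wx] <-].
have Iy : (chart_map c @` chart_dom c) (chart_map c x) by exists x.
have n1 : nbhs (chart_map c x) (chart_map c @` chart_dom c).
  by apply: open_nbhs_nbhs; split=> //; exact: chart_img_open.
have n2 : nbhs (chart_map c x) (chart_inv c @^-1` W).
  apply: (chart_inv_cont Iy); rewrite chart_mapK //.
  exact: open_nbhs_nbhs (conj oW Wx).
apply: (filterS _ (filterI n1 n2)) => z [[w cw <-]] /=.
by rewrite chart_mapK // => Ww; exists w.
Qed.

Lemma smooth_fun_on_cst W (c : R) : smooth_fun_on W (fun=> c).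
Proof. by move=> ch _ k; exact: Ck_cst. Qed.

Lemma smooth_fun_onD W f g : open W ->
  smooth_fun_on W f -> smooth_fun_on W g -> smooth_fun_on W (fun x => f x + g x).
Proof.
move=> oW sf sg c ac k.
by apply: CkD; [exact: chart_img_openI|exact: sf|exact: sg].
Qed.

Lemma smooth_fun_onM W f g : open W ->
  smooth_fun_on W f -> smooth_fun_on W g -> smooth_fun_on W (fun x => f x * g x).
Proof.
move=> oW sf sg c ac k.
by apply: CkM; [exact: chart_img_openI|exact: sf|exact: sg].
Qed.

Lemma smooth_fun_onS W W' f : open W -> W `<=` W' ->
  smooth_fun_on W' f -> smooth_fun_on W f.
Proof.
move=> oW WW' sf c ac k; move: (sf c ac k).
elim: k (fun y => _) => [|k IH] h /= [ch dh]; split=> //.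
- by move=> y [x [cx Wx] <-]; apply: ch; exists x => //; split=> //; exact: WW'.
- by move=> y [x [cx Wx] <-]; apply: ch; exists x => //; split=> //; exact: WW'.
move=> i; have [dhi ckh] := dh i; split; last exact: IH.
by move=> y [x [cx Wx] <-]; apply: dhi; exists x => //; split=> //; exact: WW'.
Qed.

(* The ring C^oo(M); [konst] embeds the real scalars as constant functions.  *)
Record cinf := Cinf {
  cinf_fun :> M -> R;
  cinfP : smooth_fun_on setT cinf_fun
}.

Lemma cinf_ext (f g : cinf) : (forall x, f x = g x) -> f = g.
Proof.
case: f g => [f Pf] [g Pg] /= /funext fg; case: _ / fg Pg => Pg.
by congr Cinf; exact: Prop_irrelevance.
Qed.

HB.instance Definition _ := gen_eqMixin cinf.
HB.instance Definition _ := gen_choiceMixin cinf.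

Definition konst (c : R) : cinf := Cinf (smooth_fun_on_cst setT c).

Definition cinf_add (f g : cinf) : cinf :=
  Cinf (smooth_fun_onD openT (cinfP f) (cinfP g)).

Definition cinf_mul (f g : cinf) : cinf :=
  Cinf (smooth_fun_onM openT (cinfP f) (cinfP g)).

Definition cinf_opp (f : cinf) : cinf := cinf_mul (konst (-1)) f.

Lemma cinf_addA : associative cinf_add.
Proof. by move=> f g h; apply: cinf_ext => x /=; rewrite addrA. Qed.
Lemma cinf_addC : commutative cinf_add.
Proof. by move=> f g; apply: cinf_ext => x /=; rewrite addrC. Qed.
Lemma cinf_add0 : left_id (konst 0) cinf_add.
Proof. by move=> f; apply: cinf_ext => x /=; rewrite add0r. Qed.
Lemma cinf_addN : left_inverse (konst 0) cinf_opp cinf_add.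
Proof. by move=> f; apply: cinf_ext => x /=; rewrite mulN1r addNr. Qed.
HB.instance Definition _ :=
  GRing.isZmodule.Build cinf cinf_addA cinf_addC cinf_add0 cinf_addN.

Lemma cinf_mulA : associative cinf_mul.
Proof. by move=> f g h; apply: cinf_ext => x /=; rewrite mulrA. Qed.
Lemma cinf_mulC : commutative cinf_mul.
Proof. by move=> f g; apply: cinf_ext => x /=; rewrite mulrC. Qed.
Lemma cinf_mul1 : left_id (konst 1) cinf_mul.
Proof. by move=> f; apply: cinf_ext => x /=; rewrite mul1r. Qed.
Lemma cinf_mulD : left_distributive cinf_mul +%R.
Proof. by move=> f g h; apply: cinf_ext => x /=; rewrite mulrDl. Qed.
HB.instance Definition _ :=
  GRing.Zmodule_isComPzRing.Build cinf cinf_mulA cinf_mulC cinf_mul1 cinf_mulD.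

End smooth_functions.

Arguments konst {R n M} c.

(* A trivialisation over an open set; what [triv_map] and [triv_inv] do      *)
(* outside [triv_dom] is irrelevant.                                         *)
Record trivialization (R : realType) (n r : nat) (M : manifold R n)
    (F : M -> lmodType R) := Trivialization {
  triv_dom : set M;
  triv_map : forall x, {linear F x -> 'rV[R]_r};
  triv_inv : forall x, 'rV[R]_r -> F x;
  triv_dom_open : open triv_dom;
  triv_mapK : forall x, triv_dom x -> cancel (triv_map x) (triv_inv x);
  triv_invK : forall x, triv_dom x -> cancel (triv_inv x) (triv_map x)
}.

Record vbundle (R : realType) (n : nat) (M : manifold R n) (r : nat) :=
  VBundle {
  fiber :> M -> lmodType R;
  trivs : set (trivialization r fiber);
  trivs_cover : forall x : M, exists2 t, trivs t & triv_dom t x;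
  trivs_smooth : forall t t', trivs t -> trivs t' ->
    forall (v : 'rV[R]_r) (j : 'I_r),
    smooth_fun_on (triv_dom t `&` triv_dom t')
                  (fun x => triv_map t' x (triv_inv t x v) 0 j)
}.

Section sections.
Variables (R : realType) (n : nat) (M : manifold R n) (r : nat).
Variable (A : vbundle M r).

Definition smooth_section (s : forall x, A x) :=
  forall t, trivs t -> forall j : 'I_r,
    smooth_fun_on (triv_dom t) (fun x => triv_map t x (s x) 0 j).

Record section := Section_ {
  section_fun :> forall x, A x;
  sectionP : smooth_section section_fun
}.

Lemma section_ext (s u : section) : (forall x, s x = u x) -> s = u.
Proof.
case: s u => [s Ps] [u Pu] /= su.
have {}su : s = u by apply: functional_extensionality_dep.
case: _ / su Pu => Pu.
by congr Section_; exact: Prop_irrelevance.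
Qed.

HB.instance Definition _ := gen_eqMixin section.
HB.instance Definition _ := gen_choiceMixin section.

Lemma smooth_section0 : smooth_section (fun x => 0).
Proof.
move=> t _ j; rewrite (_ : (fun x => _) = fun=> 0).
  exact: smooth_fun_on_cst.
by apply/funext => x; rewrite linear0 mxE.
Qed.

Lemma smooth_sectionD (s u : section) : smooth_section (fun x => s x + u x).
Proof.
move=> t tt j.
rewrite (_ : (fun x => _) =
  fun x => triv_map t x (s x) 0 j + triv_map t x (u x) 0 j).
  by apply: smooth_fun_onD;
    [exact: triv_dom_open|exact: (sectionP s)|exact: (sectionP u)].
by apply/funext => x; rewrite linearD mxE.
Qed.

Lemma smooth_sectionZ (f : cinf M) (s : section) :
  smooth_section (fun x => f x *: s x).
Proof.
move=> t tt j.
rewrite (_ : (fun x => _) = fun x => f x * triv_map t x (s x) 0 j).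
  apply: smooth_fun_onM; [exact: triv_dom_open| |exact: (sectionP s)].
  by apply: smooth_fun_onS (cinfP f) => //; exact: triv_dom_open.
by apply/funext => x; rewrite linearZ mxE.
Qed.

Definition section_zero : section := Section_ smooth_section0.
Definition section_add (s u : section) : section :=
  Section_ (smooth_sectionD s u).
Definition section_scale (f : cinf M) (s : section) : section :=
  Section_ (smooth_sectionZ f s).
Definition section_opp (s : section) : section := section_scale (konst (-1)) s.

Lemma section_addA : associative section_add.
Proof. by move=> f g h; apply: section_ext => x /=; rewrite addrA. Qed.
Lemma section_addC : commutative section_add.
Proof. by move=> f g; apply: section_ext => x /=; rewrite addrC. Qed.
Lemma section_add0 : left_id section_zero section_add.
Proof. by move=> f; apply: section_ext => x /=; rewrite add0r. Qed.
Lemma section_addN : left_inverse section_zero section_opp section_add.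
Proof. by move=> f; apply: section_ext => x /=; rewrite scaleN1r addNr. Qed.
HB.instance Definition _ :=
  GRing.isZmodule.Build section section_addA section_addC section_add0
    section_addN.

Lemma section_scaleA (f g : cinf M) (s : section) :
  section_scale f (section_scale g s) = section_scale (f * g) s.
Proof. by apply: section_ext => x /=; rewrite scalerA. Qed.
Lemma section_scale1 : left_id 1 section_scale.
Proof. by move=> s; apply: section_ext => x /=; rewrite scale1r. Qed.
Lemma section_scaleDr : right_distributive section_scale +%R.
Proof. by move=> f s u; apply: section_ext => x /=; rewrite scalerDr. Qed.
Lemma section_scaleDl (s : section) :
  {morph section_scale^~ s : f g / f + g}.
Proof. by move=> f g; apply: section_ext => x /=; rewrite scalerDl. Qed.
HB.instance Definition _ :=
  GRing.Zmodule_isLmodule.Build (cinf M) section section_scaleA section_scale1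
    section_scaleDr section_scaleDl.

End sections.

Arguments section {R n M r} A.

(* As usual, smooth tensor fields are identified with the C^oo(M)-multilinear *)
(* maps that they induce on sections: sections of A^* are C^oo(M)-linear      *)
(* functionals on sections of A, vector fields on M are derivations of        *)
(* C^oo(M), and a morphism of vector bundles is a C^oo(M)-linear map between  *)
(* modules of sections.  In particular, as non-degeneracy of a 2-form is a    *)
(* fibrewise notion, it amounts to bijectivity of omega^b on sections.        *)

Section tensors.
Variables (R : realType) (n : nat) (M : manifold R n) (r : nat).
Variable (A : vbundle M r).
Local Notation C := (cinf M).

Record dual := Dual {
  dual_fun :> section A -> C;
  dualP : scalar dual_fun
}.

Lemma dual_ext (a b : dual) : (forall X, a X = b X) -> a = b.
Proof.
case: a b => [a Pa] [b Pb] /= /funext ab; case: _ / ab Pb => Pb.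
by congr Dual; exact: Prop_irrelevance.
Qed.

HB.instance Definition _ (a : dual) :=
  GRing.isLinear.Build C (section A) C *%R (dual_fun a) (dualP a).

HB.instance Definition _ := gen_eqMixin dual.
HB.instance Definition _ := gen_choiceMixin dual.

Lemma dual_add_subproof (a b : dual) : scalar (fun X => a X + b X).
Proof. by move=> f X Y; rewrite !linearP mulrDr addrACA. Qed.
Lemma dual_scale_subproof (f : C) (a : dual) : scalar (fun X => f * a X).
Proof. by move=> g X Y; rewrite linearP mulrDr !mulrA (mulrC f g). Qed.
Lemma dual_zero_subproof : scalar (fun _ : section A => 0 : C).
Proof. by move=> g X Y; rewrite mulr0 addr0. Qed.

Definition dual_zero : dual := Dual dual_zero_subproof.
Definition dual_add (a b : dual) : dual := Dual (dual_add_subproof a b).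
Definition dual_scale (f : C) (a : dual) : dual :=
  Dual (dual_scale_subproof f a).
Definition dual_opp (a : dual) : dual := dual_scale (-1) a.

Lemma dual_addA : associative dual_add.
Proof. by move=> a b c; apply: dual_ext => X /=; rewrite addrA. Qed.
Lemma dual_addC : commutative dual_add.
Proof. by move=> a b; apply: dual_ext => X /=; rewrite addrC. Qed.
Lemma dual_add0 : left_id dual_zero dual_add.
Proof. by move=> a; apply: dual_ext => X /=; rewrite add0r. Qed.
Lemma dual_addN : left_inverse dual_zero dual_opp dual_add.
Proof. by move=> a; apply: dual_ext => X /=; rewrite mulN1r addNr. Qed.
HB.instance Definition _ :=
  GRing.isZmodule.Build dual dual_addA dual_addC dual_add0 dual_addN.

Lemma dual_scaleA (f g : C) (a : dual) :
  dual_scale f (dual_scale g a) = dual_scale (f * g) a.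
Proof. by apply: dual_ext => X /=; rewrite mulrA. Qed.
Lemma dual_scale1 : left_id 1 dual_scale.
Proof. by move=> a; apply: dual_ext => X /=; rewrite mul1r. Qed.
Lemma dual_scaleDr : right_distributive dual_scale +%R.
Proof. by move=> f a b; apply: dual_ext => X /=; rewrite mulrDr. Qed.
Lemma dual_scaleDl (a : dual) : {morph dual_scale^~ a : f g / f + g}.
Proof. by move=> f g; apply: dual_ext => X /=; rewrite mulrDl. Qed.
HB.instance Definition _ :=
  GRing.Zmodule_isLmodule.Build C dual dual_scaleA dual_scale1
    dual_scaleDr dual_scaleDl.

(* Linearity in the second argument follows from skew-symmetry. *)
Record form2 := Form2 {
  form2_fun :> section A -> section A -> C;
  form2_linear : forall Y, scalar (form2_fun^~ Y);
  form2_skew : forall X Y, form2_fun X Y = - form2_fun Y X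
}.

Lemma form2_linear_r (om : form2) X : scalar (om X).
Proof.
move=> f Y Z; rewrite form2_skew form2_linear (form2_skew om X Y).
by rewrite (form2_skew om X Z) opprD mulrN.
Qed.

Definition flat (om : form2) (X : section A) : dual :=
  Dual (form2_linear_r om X).

Lemma flat_linear (om : form2) : linear (flat om).
Proof. by move=> f X Y; apply: dual_ext => Z /=; rewrite form2_linear. Qed.

HB.instance Definition _ (om : form2) :=
  GRing.isLinear.Build C (section A) dual *:%R (flat om) (flat_linear om).

Definition form2_nondegenerate (om : form2) := bijective (flat om).

(* A bivector pi is given by the bundle map pi^# : A^* -> A, from which it   *)
(* is recovered by pi(a, b) = <b, pi^# a>.                                   *)
Record bivector := Bivector {
  sharp : {linear dual -> section A};
  sharp_skew : forall a b : dual, b (sharp a) = - a (sharp b)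
}.

Definition is_inverse (pi : bivector) (om : form2) :=
  forall X, sharp pi (flat om X) = X.

Definition is_vfield (D : C -> C) :=
  (forall (c : R) f g, D (konst c * f + g) = konst c * D f + D g) /\
  (forall f g, D (f * g) = D f * g + f * D g).

Definition is_anchor (E : lmodType C) (rho : E -> C -> C) :=
  (forall e, is_vfield (rho e)) /\
  (forall f e e' g, rho (f *: e + e') g = f * rho e g + rho e' g).

Definition Rbilinear (E : lmodType C) (br : E -> E -> E) :=
  (forall (c : R) e e' e'',
     br (konst c *: e + e') e'' = konst c *: br e e'' + br e' e'') /\
  (forall (c : R) e e' e'',
     br e (konst c *: e' + e'') = konst c *: br e e' + br e e'').

(* Compatibility of the anchor with brackets follows from these axioms. *)
Record lie_algebroid := LieAlgebroid {
  la_anchor : section A -> C -> C;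
  la_bracket : section A -> section A -> section A;
  la_anchorP : is_anchor la_anchor;
  la_bracket_bilinear : Rbilinear la_bracket;
  la_bracket_skew : forall X Y, la_bracket X Y = - la_bracket Y X;
  la_jacobi : forall X Y Z, la_bracket X (la_bracket Y Z) =
    la_bracket (la_bracket X Y) Z + la_bracket Y (la_bracket X Z);
  la_leibniz : forall X (f : C) Y, la_bracket X (f *: Y) =
    f *: la_bracket X Y + la_anchor X f *: Y
}.

Section cartan_calculus.
Variable mu : lie_algebroid.
Local Notation rho := (la_anchor mu).
Local Notation "[[ X , Y ]]" := (la_bracket mu X Y).

(* Koszul's formulas for the differential of 1- and 2-forms on A. *)
Definition d1 (a : dual) (X Y : section A) : C :=
  rho X (a Y) - rho Y (a X) - a [[X, Y]].

Definition d2 (om : form2) (X Y Z : section A) : C :=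
  rho X (om Y Z) - rho Y (om X Z) + rho Z (om X Y)
  - om [[X, Y]] Z + om [[X, Z]] Y - om [[Y, Z]] X.

Definition symplectic (om : form2) :=
  form2_nondegenerate om /\ forall X Y Z, d2 om X Y Z = 0.

Definition lieD_fun (X : section A) (b : dual) (Z : section A) : C :=
  rho X (b Z) - b [[X, Z]].

Lemma vfieldD D (f g : C) : is_vfield D -> D (f + g) = D f + D g.
Proof.
have k1 : konst 1 = 1 :> C by [].
by move=> [DD _]; have := DD 1 f g; rewrite k1 !mul1r.
Qed.

Lemma la_bracketDr X Y Z : [[X, Y + Z]] = [[X, Y]] + [[X, Z]].
Proof.
have k1 : konst 1 = 1 :> C by [].
by have := (la_bracket_bilinear mu).2 1 X Y Z; rewrite k1 !scale1r.
Qed.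

Lemma lieD_linear X b : scalar (lieD_fun X b).
Proof.
move=> f Y Z; have [vX vXM] := (la_anchorP mu).1 X.
rewrite /lieD_fun la_bracketDr la_leibniz !linearD !linearZ /=.
rewrite (vfieldD _ _ (conj vX vXM)) vXM mulrBr; ring.
Qed.

Lemma contract_d1_linear (a : dual) Y : scalar (d1 a Y).
Proof.
move=> f Z W; have [vX vXM] := (la_anchorP mu).1 Y.
rewrite /d1 la_bracketDr la_leibniz !linearD !linearZ /=.
by rewrite (vfieldD _ _ (conj vX vXM)) vXM (la_anchorP mu).2; ring.
Qed.

Definition lieD (X : section A) (b : dual) : dual := Dual (lieD_linear X b).
(* i_Y (d a) *)
Definition contract_d1 (Y : section A) (a : dual) : dual :=
  Dual (contract_d1_linear a Y).

End cartan_calculus.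

End tensors.

(* Here a vector bundle is given by its C^oo(M)-module of sections E. *)
Section courant.
Variables (R : realType) (n : nat) (M : manifold R n).
Local Notation C := (cinf M).
Variable (E : lmodType C).

Record anchored_bracket := AnchoredBracket {
  anchor : E -> C -> C;
  bracket : E -> E -> E
}.

Implicit Types (T : anchored_bracket) (I : {linear E -> E}).

Definition ab_add T T' := AnchoredBracket
  (fun e f => anchor T e f + anchor T' e f)
  (fun e e' => bracket T e e' + bracket T' e e').

Definition ab_scale (c : R) T := AnchoredBracket
  (fun e f => konst c * anchor T e f)
  (fun e e' => konst c *: bracket T e e').

Definition deform T I := AnchoredBracket
  (fun e => anchor T (I e))
  (fun e e' => bracket T (I e) e' + bracket T e (I e') - I (bracket T e e')).

(* [ip] is the scalar product of E; it is only instantiated below by the     *)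
(* canonical pairing of A (+) A^*, which is symmetric and non-degenerate.    *)
Variable ip : E -> E -> C.

Definition is_pre_courant T :=
  [/\ is_anchor (anchor T),
      Rbilinear (bracket T),
      forall e e' e'', anchor T e (ip e' e'') =
        ip (bracket T e e') e'' + ip e' (bracket T e e'') &
      forall e e' e'', anchor T e (ip e' e'') =
        ip e (bracket T e' e'' + bracket T e'' e')].

Definition is_courant T :=
  is_pre_courant T /\
  forall e e' e'', bracket T e (bracket T e' e'') =
    bracket T (bracket T e e') e'' + bracket T e' (bracket T e e'').

Definition skew_endo I := forall e e', ip (I e) e' = - ip e (I e').

Definition courant_hypersymplectic T (eps : 'Z_3 -> R)
    (S : 'Z_3 -> {linear E -> E}) :=
  [/\ forall i, skew_endo (S i),
      forall i e, S i (S i e) = konst (eps i) *: e,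
      forall i j, i != j -> forall e,
        S i (S j e) = konst (\prod_l eps l) *: S j (S i e) &
      forall i, deform (deform T (S i)) (S i) = ab_scale (eps i) T].

End courant.

Section double.
Variables (R : realType) (n : nat) (M : manifold R n) (r : nat).
Variable (A : vbundle M r).
Local Notation C := (cinf M).

(* Sections of A (+) A^*. *)
Definition double : lmodType C := (section A * dual A)%type.

Definition double_pairing (e e' : double) : C := e.2 e'.1 + e'.2 e.1.

Definition double_structure (mu : lie_algebroid A) : anchored_bracket double :=
  AnchoredBracket (fun e : double => la_anchor mu e.1)
    (fun e e' : double => (la_bracket mu e.1 e'.1,
       lieD mu e.1 e'.2 - contract_d1 mu e'.1 e.2) : double).

Definition bivector_endo_fun (pi : bivector A) (e : double) : double :=
  (sharp pi e.2, 0).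

Lemma bivector_endo_linear pi : linear (bivector_endo_fun pi).
Proof.
move=> f e e'; rewrite /bivector_endo_fun /= linearP.
by congr (_, _); rewrite /= scaler0 addr0.
Qed.

HB.instance Definition _ pi :=
  GRing.isLinear.Build C double double *:%R (bivector_endo_fun pi)
    (bivector_endo_linear pi).

Definition bivector_endo (pi : bivector A) : {linear double -> double} :=
  bivector_endo_fun pi.

(* mu + mu_pi *)
Definition triangular_double (mu : lie_algebroid A) (pi : bivector A) :=
  ab_add (double_structure mu)
         (deform (double_structure mu) (bivector_endo pi)).

Definition hyper_endo_fun (c : R) (om : form2 A) (pi : bivector A)
    (e : double) : double := (konst c *: sharp pi e.2, flat om e.1).

Lemma hyper_endo_linear c om pi : linear (hyper_endo_fun c om pi).
Proof.
move=> f e e'; rewrite /hyper_endo_fun /= !linearP.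
by congr (_, _); rewrite /= scalerDr !scalerA mulrC.
Qed.

HB.instance Definition _ c om pi :=
  GRing.isLinear.Build C double double *:%R (hyper_endo_fun c om pi)
    (hyper_endo_linear c om pi).

(* The endomorphism with matrix (0, c pi^#; om^b, 0) of A (+) A^*. *)
Definition hyper_endo (c : R) (om : form2 A) (pi : bivector A) :
  {linear double -> double} := hyper_endo_fun c om pi.

(* Indices are computed modulo 3; the index 3 is 0. *)
Definition lie_hypersymplectic (mu : lie_algebroid A) (eps : 'Z_3 -> R)
    (om : 'Z_3 -> form2 A) (pi : 'Z_3 -> bivector A) :=
  let N (i : 'Z_3) X := sharp (pi (i - 1)) (flat (om (i + 1)) X) in
  [/\ forall i, symplectic mu (om i),
      forall i, is_inverse (pi i) (om i) &
      forall i X, N i (N i X) = konst (eps i) *: X].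

End double.

(* Main.v *)
(* Since S_i^2 = eps_i, the condition Theta_{S_i,S_i} = eps_i Theta says that *)
(* the torsion [Se,Se'] - S[Se,e'] - S[e,Se'] + eps_i [e,e'] vanishes. The    *)
(* torsion commutes with S_i up to sign and S_i exchanges A and A^*, so it    *)
(* only has to be computed on sections of A. There its A-component vanishes   *)
(* iff d omega_i = 0, and its A^*-component is a multiple of d omega_k as     *)
(* soon as omega_i^b pi_k^# omega_i^b is a multiple of omega_k^b, which is    *)
(* what the algebraic conditions give. If pi_k is Poisson, mu + mu_{pi_k} is  *)
(* the pullback of mu by the orthogonal automorphism 1 + pi_k^#, hence        *)
(* Courant.                                                                   *)

Require Import Defs.
From mathcomp Require Import all_boot all_order all_algebra.
From mathcomp Require Import all_classical all_reals all_analysis.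
From mathcomp Require Import ring ssrAC.

Set Implicit Arguments.
Unset Strict Implicit.
Unset Printing Implicit Defensive.

Import Order.TTheory GRing.Theory Num.Theory.
Local Open Scope ring_scope.

(** The proof combines an algebraic and a differential equivalence. Algebraically,
    [pi_{i-1}^# omega_{i+1}^b] and [pi_{i+1}^# omega_{i-1}^b] are mutually inverse, so
    [N_i^2 = eps_i] means that they agree up to the factor [eps_i] ([sharp_flat_square]). This is
    the relation between [S_{i-1}] and [S_{i+1}] read on [A]; [flat_sharp_swap] carries it to [A^*].

    Differentially, the deformation condition for [S_i] is the vanishing of a torsion ([deform2E])
    that is determined by its values on sections of [A] ([torsion_triangular]). Its [A]-component
    vanishes iff [omega_i] is closed, whence [closed_of_deform2]. Conversely, the swap relation
    makes [omega_i^b pi_k^# omega_i^b] a multiple of [omega_k^b], and closedness of both forms then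
    kills the [A^*]-component ([deform2_of_closed]). Closedness of [omega_k] also makes [pi_k]
    Poisson, so that [1 + pi_k^#] pulls [mu] back to [mu + mu_{pi_k}]
    ([triangular_double_is_courant]). *)

Section smooth_ring.
Variables (R : realType) (n : nat) (M : manifold R n).

Lemma konst1 : konst 1 = 1 :> cinf M. Proof. by []. Qed.

Lemma konstM (a b : R) : konst (a * b) = konst a * konst b :> cinf M.
Proof. exact: cinf_ext. Qed.

Lemma konstD (a b : R) : konst (a + b) = konst a + konst b :> cinf M.
Proof. exact: cinf_ext. Qed.

Lemma cinf_cube_eq0 (f : cinf M) : f * f * f = 0 -> f = 0.
Proof.
move=> f3; apply: cinf_ext => x /=.
have /= := congr1 (fun g : cinf M => g x) f3.
by move/eqP; rewrite !mulf_eq0 -!orbA => /or3P[] /eqP.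
Qed.

(** Multiplication by the constant function 1/2 halves; the double deformation produces the torsion
    with a factor 2. *)
Lemma scale_double_inj (E : lmodType (cinf M)) (u v : E) :
  u + u = v + v -> u = v.
Proof.
have half (w : E) : w = konst 2^-1 *: (w + w).
  by rewrite scalerDr -scalerDl -konstD -[2^-1]mul1r -splitr scale1r.
by move=> uv; rewrite [u]half uv -half.
Qed.

End smooth_ring.

(** * Brackets, anchors and the torsion of an endomorphism *)

Section bilinear.
Variables (R : realType) (n : nat) (M : manifold R n) (E : lmodType (cinf M)).

Section bracket.
Variable br : E -> E -> E.
Hypothesis brP : Rbilinear br.

Lemma RbilinearDl x y z : br (x + y) z = br x z + br y z.
Proof. by have := brP.1 1 x y z; rewrite konst1 !scale1r. Qed.

Lemma RbilinearDr x y z : br x (y + z) = br x y + br x z.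
Proof. by have := brP.2 1 x y z; rewrite konst1 !scale1r. Qed.

Lemma Rbilinear0l z : br 0 z = 0.
Proof. by apply: (addrI (br 0 z)); rewrite -RbilinearDl !addr0. Qed.

Lemma Rbilinear0r z : br z 0 = 0.
Proof. by apply: (addrI (br z 0)); rewrite -RbilinearDr !addr0. Qed.

Lemma RbilinearZl c x z : br (konst c *: x) z = konst c *: br x z.
Proof. by have := brP.1 c x 0 z; rewrite Rbilinear0l !addr0. Qed.

Lemma RbilinearZr c x z : br x (konst c *: z) = konst c *: br x z.
Proof. by have := brP.2 c x z 0; rewrite Rbilinear0r !addr0. Qed.

End bracket.

Section anchor.
Variable rho : E -> cinf M -> cinf M.
Hypothesis rhoP : is_anchor rho.

Lemma anchorDl x y f : rho (x + y) f = rho x f + rho y f.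
Proof. by have := rhoP.2 1 x y f; rewrite mul1r scale1r. Qed.

Lemma anchor0l f : rho 0 f = 0.
Proof. by apply: (addrI (rho 0 f)); rewrite -anchorDl !addr0. Qed.

Lemma anchorZl g x f : rho (g *: x) f = g * rho x f.
Proof. by have := rhoP.2 g x 0 f; rewrite anchor0l !addr0. Qed.

Lemma anchorD x f g : rho x (f + g) = rho x f + rho x g.
Proof. exact: vfieldD (rhoP.1 x). Qed.

Lemma anchorM x f g : rho x (f * g) = rho x f * g + f * rho x g.
Proof. exact: (rhoP.1 x).2. Qed.

Lemma anchor0 x : rho x 0 = 0.
Proof. by apply: (addrI (rho x 0)); rewrite -anchorD !addr0. Qed.

Lemma anchorZ x (c : R) f : rho x (konst c * f) = konst c * rho x f.
Proof. by have := (rhoP.1 x).1 c f 0; rewrite anchor0 !addr0. Qed.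

Lemma anchorN x f : rho x (- f) = - rho x f.
Proof. by apply: (addrI (rho x f)); rewrite -anchorD !subrr anchor0. Qed.

Lemma anchorNl x f : rho (- x) f = - rho x f.
Proof. by apply: (addrI (rho x f)); rewrite -anchorDl !subrr anchor0l. Qed.

End anchor.

Section torsion.
Variables (T : anchored_bracket E) (S : {linear E -> E}) (c : R).
Hypotheses (brP : Rbilinear (bracket T)) (rhoP : is_anchor (anchor T)).
Hypothesis S2 : forall e, S (S e) = konst c *: e.

(** When [S^2 = c], this is the Nijenhuis torsion, with [c [e, e']] in place of [S^2 [e, e']]. *)
Definition torsion (e e' : E) : E :=
  bracket T (S e) (S e') - S (bracket T (S e) e') - S (bracket T e (S e'))
  + konst c *: bracket T e e'.

Lemma torsionDl x y z : torsion (x + y) z = torsion x z + torsion y z.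
Proof.
rewrite /torsion !(linearD S) !(RbilinearDl brP) !(linearD S) /=.
rewrite scalerDr !opprD.
by rewrite (AC ((2*2*2)*2) ((1*3*5*7)*(2*4*6*8))).
Qed.

Lemma torsionDr x y z : torsion z (x + y) = torsion z x + torsion z y.
Proof.
rewrite /torsion !(linearD S) !(RbilinearDr brP) !(linearD S) /=.
rewrite scalerDr !opprD.
by rewrite (AC ((2*2*2)*2) ((1*3*5*7)*(2*4*6*8))).
Qed.

(** Since [S^2 = c], replacing [e] by [S e] only permutes the four terms, up to applying [- S]. *)
Lemma torsion_endol e e' : torsion (S e) e' = - S (torsion e e').
Proof.
rewrite /torsion !S2 !(RbilinearZl brP).
rewrite !(linearZZ S, linearD S, linearN S) /= !S2 !opprD !opprK.
by rewrite (AC (3*1) ((3*4*1)*2)).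
Qed.

Lemma torsion_endor e e' : torsion e (S e') = - S (torsion e e').
Proof.
rewrite /torsion !S2 !(RbilinearZr brP).
rewrite !(linearZZ S, linearD S, linearN S) /= !S2 !opprD !opprK.
by rewrite (AC (3*1) ((2*1*4)*3)).
Qed.

Lemma deform2E : deform (deform T S) S = ab_scale c T <->
  forall e e', torsion e e' = 0.
Proof.
(* The double deformation expands to [2[Se,Se'] - 2S[Se,e'] - 2S[e,Se'] + 3c[e,e']]. *)
have key e e' : bracket (deform (deform T S) S) e e' - konst c *: bracket T e e'
    = torsion e e' + torsion e e'.
  rewrite /= /torsion !S2 (RbilinearZl brP) (RbilinearZr brP).
  rewrite !(linearD S, linearN S) /= S2 !opprD !opprK.
  by rewrite addrA addrK (AC (3*3*2) ((2*3*6*1)*(4*7*8*5))).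
split=> [TS e e'|t0].
  apply: scale_double_inj; rewrite -key TS /= subrr; exact/esym/addr0.
rewrite /ab_scale /deform /=; congr AnchoredBracket.
  by apply/funext => e; apply/funext => f /=; rewrite S2 (anchorZl rhoP).
apply/funext => e; apply/funext => e'; have := key e e'.
by rewrite t0 addr0 => /eqP; rewrite subr_eq0 => /eqP.
Qed.

End torsion.

End bilinear.

(** * Cartan calculus of the Lie algebroid *)

Section cartan.
Variables (R : realType) (n : nat) (M : manifold R n) (r : nat).
Variables (A : vbundle M r) (mu : lie_algebroid A).
Implicit Types (X Y Z W : section A) (a b : dual A) (f g : cinf M).
Local Notation rho := (la_anchor mu).
Local Notation "[[ X , Y ]]" := (la_bracket mu X Y).

Lemma dual_addE a b X : (a + b) X = a X + b X. Proof. by []. Qed.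

Lemma dual_zeroE X : (0 : dual A) X = 0. Proof. by []. Qed.

Lemma dual_scaleE f a X : (f *: a) X = f * a X. Proof. by []. Qed.

Lemma dual_oppE a X : (- a) X = - a X. Proof. exact: mulN1r. Qed.

Lemma dual_addr a X Y : a (X + Y) = a X + a Y. Proof. exact: linearD. Qed.

Lemma dual_oppr a X : a (- X) = - a X. Proof. exact: linearN. Qed.

Lemma dual_scaler a f X : a (f *: X) = f * a X. Proof. exact: linearZ. Qed.

Definition dualE :=
  (dual_addE, dual_zeroE, dual_oppE, dual_scaleE,
   dual_addr, dual_oppr, dual_scaler).

Definition la_anchorE := (anchorD (la_anchorP mu), anchorN (la_anchorP mu),
  anchorDl (la_anchorP mu), anchorNl (la_anchorP mu)).

Definition anchor_curvature X Y f :=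
  rho [[X, Y]] f - (rho X (rho Y f) - rho Y (rho X f)).

Lemma anchor_curvatureM X Y f g : anchor_curvature X Y (f * g) =
  anchor_curvature X Y f * g + f * anchor_curvature X Y g.
Proof.
rewrite /anchor_curvature !(anchorM (la_anchorP mu)).
rewrite !(anchorD (la_anchorP mu)) !(anchorM (la_anchorP mu)); ring.
Qed.

(** In the Jacobi identity for [X], [Y], [f *: Z], the Leibniz rule and the Jacobi identity for [X],
    [Y], [Z] cancel everything except the curvature term. *)
Lemma anchor_curvature_scale X Y f Z : anchor_curvature X Y f *: Z = 0.
Proof.
have := la_jacobi mu X Y (f *: Z).
rewrite !(la_leibniz, la_bracketDr) (la_jacobi mu X Y Z) scalerDr.
rewrite (AC (3*2) ((1*2*3*4)*5)) [RHS](AC (2*(2*2)) ((1*3*5*4)*(2*6))).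
move/addrI; rewrite /anchor_curvature !scalerBl => ->.
by rewrite addrK subrr.
Qed.

(* C^oo(M) is reduced and D(a(Z)) a(Z) = 0 for the derivation D = curvature,  *)
(* so D kills a(Z); this avoids the bump functions needed for general         *)
(* arguments.                                                                 *)
Lemma anchor_bracket X Y a Z :
  rho [[X, Y]] (a Z) = rho X (rho Y (a Z)) - rho Y (rho X (a Z)).
Proof.
apply/eqP; rewrite -subr_eq0; apply/eqP; rewrite -/(anchor_curvature X Y (a Z)).
set D := anchor_curvature X Y; set f := a Z.
have Df g : D g * f = 0.
  by rewrite /f -dual_scaler anchor_curvature_scale linear0.
have D0 : D 0 = 0.
  rewrite /D /anchor_curvature !(anchor0 (la_anchorP mu)); ring.
apply: cinf_cube_eq0.
have := congr1 (fun h => D h * D f) (Df f).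
rewrite /D anchor_curvatureM -/D -/f D0 mul0r mulrDl.
by rewrite Df mul0r add0r.
Qed.

Lemma lieDB X a b : lieD mu X (a - b) = lieD mu X a - lieD mu X b.
Proof.
by apply: dual_ext => W; rewrite !dualE /= /lieD_fun !dualE !la_anchorE; ring.
Qed.

Lemma contract_d1B X a b :
  contract_d1 mu X (a - b) = contract_d1 mu X a - contract_d1 mu X b.
Proof.
by apply: dual_ext => W; rewrite !dualE /= /d1 !dualE !la_anchorE; ring.
Qed.

Lemma lieDZ X (c : R) a : lieD mu X (konst c *: a) = konst c *: lieD mu X a.
Proof.
apply: dual_ext => W; rewrite !dualE /= /lieD_fun !dualE.
by rewrite (anchorZ (la_anchorP mu)); ring.
Qed.

Lemma contract_d1Z X (c : R) a :
  contract_d1 mu X (konst c *: a) = konst c *: contract_d1 mu X a.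
Proof.
apply: dual_ext => W; rewrite !dualE /= /d1 !dualE.
by rewrite !(anchorZ (la_anchorP mu)); ring.
Qed.

Lemma la_bracket0l X : [[0, X]] = 0.
Proof. exact: Rbilinear0l (la_bracket_bilinear mu) _. Qed.

Lemma la_bracket0r X : [[X, 0]] = 0.
Proof. exact: Rbilinear0r (la_bracket_bilinear mu) _. Qed.

Lemma lieD0r X : lieD mu X 0 = 0.
Proof. by rewrite -[X in lieD mu _ X](subrr 0) lieDB subrr. Qed.

Lemma contract_d10r X : contract_d1 mu X 0 = 0.
Proof. by rewrite -[X in contract_d1 mu _ X](subrr 0) contract_d1B subrr. Qed.

Lemma lieD0l a : lieD mu 0 a = 0.
Proof.
apply: dual_ext => W; rewrite /= /lieD_fun la_bracket0l linear0.
by rewrite (anchor0l (la_anchorP mu)) subrr.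
Qed.

Lemma contract_d10l a : contract_d1 mu 0 a = 0.
Proof.
apply: dual_ext => W; rewrite /= /d1 la_bracket0l !linear0.
by rewrite (anchor0l (la_anchorP mu)) (anchor0 (la_anchorP mu)) !subr0.
Qed.

Definition cartan0 := (la_bracket0l, la_bracket0r, lieD0l, lieD0r,
  contract_d10l, contract_d10r).

Lemma lieD_bracket X Y a :
  lieD mu [[X, Y]] a = lieD mu X (lieD mu Y a) - lieD mu Y (lieD mu X a).
Proof.
apply: dual_ext => W; rewrite !dualE /= /lieD_fun /= /lieD_fun !la_anchorE.
rewrite (la_jacobi mu X Y W) !dualE anchor_bracket; ring.
Qed.

Lemma lieD_contract_d1 X Z b : lieD mu X (contract_d1 mu Z b) =
  contract_d1 mu [[X, Z]] b + contract_d1 mu Z (lieD mu X b).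
Proof.
apply: dual_ext => W; rewrite !dualE /= /lieD_fun /= /d1 /= /lieD_fun.
rewrite !la_anchorE (la_jacobi mu X Z W) !dualE !anchor_bracket; ring.
Qed.

(** This is Cartan's formula [L_Y = i_Y d + d i_Y] combined with [d d = 0]. *)
Lemma contract_d1_comp Y Z a : contract_d1 mu Z (contract_d1 mu Y a) =
  contract_d1 mu Z (lieD mu Y a).
Proof.
apply: dual_ext => W; rewrite /= /d1 /= /lieD_fun /d1 !la_anchorE.
rewrite anchor_bracket; ring.
Qed.

End cartan.

(** * Pullback of Courant structures, and the standard one on the double *)

Section courant_pullback.
Variables (R : realType) (n : nat) (M : manifold R n) (E : lmodType (cinf M)).
Variables (ip : E -> E -> cinf M) (T T' : anchored_bracket E) (phi : E -> E).
Hypotheses (phi_linear : linear phi) (phi_inj : injective phi).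
Hypothesis phi_ip : forall e e', ip (phi e) (phi e') = ip e e'.
Hypothesis phi_anchor : forall e f, anchor T' e f = anchor T (phi e) f.
Hypothesis phi_bracket :
  forall e e', phi (bracket T' e e') = bracket T (phi e) (phi e').

(** Each axiom can be tested after applying [phi], which is injective and preserves [ip]. *)
Lemma courant_pullback : is_courant ip T -> is_courant ip T'.
Proof.
have phiD x y : phi (x + y) = phi x + phi y.
  by have := phi_linear 1 x y; rewrite !scale1r.
move=> [[rhoP brP ip1 ip2] jac]; split; first split.
- split=> [e|f e e' g]; last by rewrite !phi_anchor phi_linear rhoP.2.
  by split=> *; rewrite !phi_anchor ?(rhoP.1 _).1 ?(rhoP.1 _).2.
- by split=> *; apply: phi_inj; rewrite !(phi_linear, phi_bracket)
    ?brP.1 ?brP.2.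
- move=> e e' e''; rewrite phi_anchor -[ip e' e'']phi_ip ip1.
  by rewrite -!phi_bracket !phi_ip.
- move=> e e' e''; rewrite phi_anchor -[ip e' e'']phi_ip ip2.
  by rewrite -!phi_bracket -phiD phi_ip.
- by move=> e e' e''; apply: phi_inj; rewrite phiD !phi_bracket jac.
Qed.

End courant_pullback.

Section double_courant.
Variables (R : realType) (n : nat) (M : manifold R n) (r : nat).
Variables (A : vbundle M r) (mu : lie_algebroid A).
Implicit Types (X Y Z W : section A) (a b : dual A) (f g : cinf M).
Local Notation rho := (la_anchor mu).
Local Notation "[[ X , Y ]]" := (la_bracket mu X Y).

Lemma double_is_courant :
  is_courant (double_pairing (A := A)) (double_structure mu).
Proof.
have rhoP := la_anchorP mu; have brP := la_bracket_bilinear mu.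
split; first split.
- split=> [e|f e e' g /=]; first exact: rhoP.1.
  exact: rhoP.2.
- split=> c [X a] [Y b] [Z d] /=; congr (_, _).
  + exact: brP.1.
  + apply: dual_ext => W; rewrite !dualE /= /lieD_fun /d1 !dualE.
    by rewrite brP.1 rhoP.2 !la_anchorE !(anchorZ rhoP) !dualE; ring.
  + exact: brP.2.
  + apply: dual_ext => W; rewrite !dualE /= /lieD_fun /d1 !dualE.
    by rewrite brP.1 rhoP.2 !la_anchorE !(anchorZ rhoP) !dualE; ring.
- move=> [X a] [Y b] [Z d]; rewrite /double_pairing /= /lieD_fun /d1.
  rewrite !la_anchorE (la_bracket_skew mu Z Y) !dualE; ring.
- move=> [X a] [Y b] [Z d]; rewrite /double_pairing /= /lieD_fun /d1.
  rewrite (la_bracket_skew mu Z Y) (la_bracket_skew mu Z X).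
  rewrite (la_bracket_skew mu Y X) !la_anchorE !dualE; ring.
- move=> [X a] [Y b] [Z d] /=; congr (_, _); first exact: la_jacobi.
  rewrite !(lieDB, contract_d1B) lieD_bracket !lieD_contract_d1.
  rewrite contract_d1_comp.
  by apply: dual_ext => W; rewrite !dualE; ring.
Qed.

End double_courant.

(** * Closed forms, Poisson bivectors and the triangular double *)

Section triangular.
Variables (R : realType) (n : nat) (M : manifold R n) (r : nat).
Variables (A : vbundle M r) (mu : lie_algebroid A).
Implicit Types (X Y Z W : section A) (a b : dual A) (om : form2 A).
Local Notation "[[ X , Y ]]" := (la_bracket mu X Y).

(** The right-hand side is the [A^*]-part of the bracket of [X + om^b X] and [Y + om^b Y]:
    closedness says that the graph of [om^b] is stable under the bracket. *)
Lemma d2_eq0E om : (forall X Y Z, d2 mu om X Y Z = 0) <->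
  forall X Y, flat om [[X, Y]] =
    lieD mu X (flat om Y) - contract_d1 mu Y (flat om X).
Proof.
have key X Y Z : d2 mu om X Y Z =
    (lieD mu X (flat om Y) - contract_d1 mu Y (flat om X)) Z
    - flat om [[X, Y]] Z.
  rewrite !dualE /= /lieD_fun /d1 /= /d2 (form2_skew om [[Y, Z]] X).
  by rewrite (form2_skew om [[X, Z]] Y); ring.
split=> [d0 X Y|flatE X Y Z]; last by rewrite key flatE subrr.
by apply: dual_ext => Z; apply/eqP; rewrite eq_sym -subr_eq0 -key d0.
Qed.

Lemma sharpK om (pi : bivector A) :
  form2_nondegenerate om -> is_inverse pi om -> cancel (sharp pi) (flat om).
Proof.
move=> [g fK gK] pK a; rewrite -[a]gK.
by rewrite pK.
Qed.

Lemma triangular_double_is_courant om (pi : bivector A) :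
  form2_nondegenerate om -> is_inverse pi om ->
  (forall X Y Z, d2 mu om X Y Z = 0) ->
  is_courant (double_pairing (A := A)) (triangular_double mu pi).
Proof.
move=> om_nd pK /d2_eq0E flatE; have wK := sharpK om_nd pK.
have [ [rhoP brP _ _] _] := double_is_courant mu.
pose P : {linear Defs.double A -> Defs.double A} := bivector_endo pi.
have P2 e : P (P e) = 0 by rewrite /P /= /bivector_endo_fun /= linear0.
(* Closedness of [om], evaluated at [pi^# a] and [pi^# b], is the Poisson condition on [pi]. *)
have poisson a b :
    sharp pi (lieD mu (sharp pi a) b - contract_d1 mu (sharp pi b) a)
    = [[sharp pi a, sharp pi b]].
  by rewrite -[in RHS](pK [[_, _]]) flatE !wK.
apply: (courant_pullback (T := double_structure mu) (phi := fun e => e + P e))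
  (double_is_courant mu).
- move=> f x y; rewrite linearP scalerDr; exact: addrACA.
- move=> x y xy; have Pxy : P x = P y.
    by have := congr1 P xy; rewrite !(linearD P) !P2 !addr0.
  by move: xy; rewrite Pxy => /addIr.
- move=> [X a] [Y b]; rewrite /double_pairing /= !addr0 !dualE.
  by rewrite (sharp_skew pi a b); ring.
- by move=> e f; rewrite (anchorDl rhoP).
- move=> e e'; set br := bracket (double_structure mu).
  (* The Poisson condition in terms of [P]; with [P^2 = 0] it makes [1 + P] intertwine the two
     brackets. *)
  have Pbr : P (br (P e) e') + P (br e (P e')) = br (P e) (P e').
    case: e e' => [X a] [Y b]; rewrite -linearD.
    rewrite /P /br /= /bivector_endo_fun /= !cartan0 subr0 sub0r poisson.
    by rewrite subrr.
  rewrite [br (e + P e) _](RbilinearDl brP) !(RbilinearDr brP) -/br -Pbr.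
  have -> : bracket (triangular_double mu pi) e e' =
      br e e' + (br (P e) e' + br e (P e') - P (br e e')) by [].
  rewrite !(linearD P) (linearN P) P2 subr0; set x := br e e'; set y := P x.
  by rewrite (AC ((1*3)*(1*2)) ((1*3)*(2*(6*7))*(5*4))) /= addrN addr0.
Qed.

(** If [pi] inverts [om], the [A]-component is [c] times the defect in [d2_eq0E], read through
    [pi^#]; [pi'] enters only the [A^*]-component. *)
Lemma torsion_triangular om (pi pi' : bivector A) (c : R) X Y :
  torsion (triangular_double mu pi') (hyper_endo c om pi) c (X, 0) (Y, 0) =
  (konst c *: ([[X, Y]] -
    sharp pi (lieD mu X (flat om Y) - contract_d1 mu Y (flat om X))),
   let N Z := sharp pi' (flat om Z) in
   lieD mu (N X) (flat om Y) - contract_d1 mu (N Y) (flat om X)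
   - flat om ([[N X, Y]] + sharp pi' (contract_d1 mu Y (flat om X)))
   - flat om ([[X, N Y]] - sharp pi' (lieD mu X (flat om Y)))).
Proof.
rewrite /torsion /= /hyper_endo_fun /= /bivector_endo_fun /=.
have p0 (p : bivector A) : sharp p 0 = 0 by exact: linear0.
have pN (p : bivector A) a : sharp p (- a) = - sharp p a by exact: linearN.
rewrite !(p0, scaler0, cartan0, subr0, addr0, add0r, sub0r).
congr (_, _); rewrite /= !(p0, oppr0, scaler0, addr0, add0r, subr0, sub0r).
  by rewrite (linearB (sharp pi)) pN !scalerN opprK !scalerBr opprB addrC.
by rewrite pN opprK.
Qed.

End triangular.

(** * The deformation condition against closedness *)

Section nijenhuis.
Variables (R : realType) (n : nat) (M : manifold R n) (r : nat).
Variables (A : vbundle M r) (mu : lie_algebroid A).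
Implicit Types (X Y Z W : section A) (a b : dual A).
Variables (om : form2 A) (pi pi' : bivector A) (c : R).
Hypotheses (om_nd : form2_nondegenerate om) (piK : is_inverse pi om).
Hypothesis c2 : c * c = 1.

Lemma hyper_endo2 e :
  hyper_endo c om pi (hyper_endo c om pi e) = konst c *: e.
Proof.
case: e => X a; rewrite /= /hyper_endo_fun /= piK.
congr (_, _); rewrite /= linearZ /= sharpK //.
Qed.

Lemma hyper_endo_skew :
  skew_endo (double_pairing (A := A)) (hyper_endo c om pi).
Proof.
move=> [X a] [Y b]; rewrite /double_pairing /= !dualE (sharp_skew pi a b).
by rewrite (form2_skew om X Y); ring.
Qed.

Lemma closed_of_deform2 :
  is_courant (double_pairing (A := A)) (triangular_double mu pi') ->
  deform (deform (triangular_double mu pi') (hyper_endo c om pi))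
    (hyper_endo c om pi) = ab_scale c (triangular_double mu pi') ->
  forall X Y Z, d2 mu om X Y Z = 0.
Proof.
move=> [[rhoP brP _ _] _] /(deform2E brP rhoP hyper_endo2) tor0.
apply: (d2_eq0E mu om).2 => X Y.
have := congr1 (fun e : Defs.double A => konst c *: e.1) (tor0 (X, 0) (Y, 0)).
rewrite torsion_triangular /= scaler0 scalerA -konstM c2 scale1r.
by move/eqP; rewrite subr_eq0 => /eqP ->; rewrite sharpK.
Qed.

Lemma deform2_of_closed (om' : form2 A) (d : R) :
  is_courant (double_pairing (A := A)) (triangular_double mu pi') ->
  (forall X Y Z, d2 mu om X Y Z = 0) ->
  (forall X Y Z, d2 mu om' X Y Z = 0) ->
  (forall X, flat om (sharp pi' (flat om X)) = konst d *: flat om' X) ->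
  deform (deform (triangular_double mu pi') (hyper_endo c om pi))
    (hyper_endo c om pi) = ab_scale c (triangular_double mu pi').
Proof.
move=> [[rhoP brP _ _] _] /d2_eq0E cl /d2_eq0E cl' wPw.
have torXY X Y : torsion (triangular_double mu pi') (hyper_endo c om pi) c
    (X, 0) (Y, 0) = 0.
  rewrite torsion_triangular -cl piK subrr scaler0; congr (_, _).
  rewrite /= !(linearD (flat om), linearN (flat om)) /= !cl !wPw.
  (* By closedness of [om] and [om'], this is [om^b pi'^# om^b = d om'^b] evaluated at [[X, Y]]. *)
  have -> : flat om (sharp pi' (lieD mu X (flat om Y))) =
      flat om (sharp pi' (contract_d1 mu Y (flat om X))) +
      konst d *: (lieD mu X (flat om' Y) - contract_d1 mu Y (flat om' X)).
    by rewrite -cl' -wPw cl !linearB addrC subrK.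
  by rewrite lieDZ contract_d1Z; apply: dual_ext => Z; rewrite !dualE; ring.
apply/(deform2E brP rhoP hyper_endo2) => e e'.
(* As [om^b pi^# = 1], the summand [A^*] is the image of [A] under the endomorphism, so [torXY]
   suffices. *)
have dec (x : Defs.double A) :
    x = ((x.1, 0) : Defs.double A) + hyper_endo c om pi (sharp pi x.2, 0).
  case: x => X a; rewrite /= /hyper_endo_fun /= sharpK // linear0 scaler0.
  by congr (_, _); rewrite /= ?addr0 ?add0r.
rewrite (dec e) (dec e') (torsionDl _ _ brP) !(torsionDr _ _ brP).
rewrite !(torsion_endol brP hyper_endo2) !(torsion_endor brP hyper_endo2).
by rewrite !torXY !(linear0, oppr0, addr0).
Qed.

End nijenhuis.

(** * Algebra of the three forms, and the equivalence *)

Section swap.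
Variables (R : realType) (n : nat) (M : manifold R n) (r : nat).
Variables (A : vbundle M r).
Implicit Types (X Y Z W : section A) (a b : dual A).
Variables (om om' : form2 A) (pi pi' : bivector A) (c : R).
Hypotheses (om_nd : form2_nondegenerate om) (piK : is_inverse pi om).
Hypotheses (om'_nd : form2_nondegenerate om') (pi'K : is_inverse pi' om').
Hypothesis c2 : c * c = 1.

(** [pi'^# om^b] is the inverse of [pi^# om'^b]. *)
Lemma sharp_flat_square :
  (forall X, sharp pi (flat om' (sharp pi (flat om' X))) = konst c *: X) <->
  (forall X, sharp pi (flat om' X) = konst c *: sharp pi' (flat om X)).
Proof.
split=> [N2 X|swap X].
  have := congr1 (fun Y => sharp pi' (flat om Y)) (N2 X).
  by rewrite (sharpK om_nd piK) pi'K !linearZ.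
by rewrite swap (sharpK om_nd piK) pi'K.
Qed.

(** Compose with [om'^b] on the left and [pi'^#] on the right; the scalar [c] is its own inverse. *)
Lemma flat_sharp_swap :
  (forall X, sharp pi (flat om' X) = konst c *: sharp pi' (flat om X)) ->
  forall a, flat om (sharp pi' a) = konst c *: flat om' (sharp pi a).
Proof.
move=> swap a; have := congr1 (flat om') (swap (sharp pi' a)).
rewrite (sharpK om'_nd pi'K) => ->.
by rewrite !linearZ /= (sharpK om'_nd pi'K) scalerA -konstM c2 scale1r.
Qed.

End swap.

Lemma Z3_neq (l : 'Z_3) : l - 1 != l + 1.
Proof. by case: l => [[|[|[|]]]]. Qed.

Lemma Z3_pair (i j : 'Z_3) : i != j ->
  exists l, i = l - 1 /\ j = l + 1 \/ j = l - 1 /\ i = l + 1.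
Proof.
(* The three indices sum to 0 in ['Z_3], so this is the remaining one. *)
exists (- (i + j)).
by case: i j H => [[|[|[|]]] ? //] [[|[|[|]]] ? //] _;
  (left; split; exact: val_inj) || (right; split; exact: val_inj).
Qed.

Lemma Z3_prod (R : realType) (eps : 'Z_3 -> R) l :
  \prod_i eps i = eps (l - 1) * eps (l + 1) * eps l.
Proof.
rewrite (bigD1 (l - 1)) // (bigD1 (l + 1)) 1?eq_sym ?Z3_neq //=.
rewrite (big_pred1 l) ?mulrA // => i.
by case: l i => [[|[|[|]]] ? //] [[|[|[|]]] ? //].
Qed.

Theorem corollary8p2 (R : realType) (n r : nat) (M : manifold R n)
    (A : vbundle M r) (mu : lie_algebroid A) (eps : 'Z_3 -> R)
    (omega : 'Z_3 -> form2 A) (pi : 'Z_3 -> bivector A) (k : 'Z_3)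
    (eps_sign : forall i, eps i = 1 \/ eps i = -1)
    (omega_nondeg : forall i, form2_nondegenerate (omega i))
    (pi_inverse : forall i, is_inverse (pi i) (omega i)) :
  lie_hypersymplectic mu eps omega pi <->
  is_courant (double_pairing (A := A)) (triangular_double mu (pi k)) /\
  courant_hypersymplectic (double_pairing (A := A))
    (triangular_double mu (pi k)) eps
    (fun i => hyper_endo (eps i) (omega i) (pi i)).
Proof.
have eps2 i : eps i * eps i = 1.
  by case: (eps_sign i) => ->; rewrite ?mulrNN mulr1.
pose N i j X := sharp (pi i) (flat (omega j) X).
have square i j c := sharp_flat_square c (omega_nondeg i) (pi_inverse i)
  (pi_inverse j).
split=> [[symp _ N2]|[cou [_ _ anti deform2]]].
(* Here [c] is the sign of the third index; being its own inverse, it serves both orders of [i] and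
   [j]. *)
- have swap i j : i != j -> exists c, [/\ c * c = 1,
      \prod_m eps m = eps i * eps j * c &
      forall X, N i j X = konst c *: N j i X].
    move=> /Z3_pair[l [] [-> ->]]; exists (eps l); rewrite (Z3_prod eps l).
      by split=> //; apply/square/(N2 l).
    split=> //; first by rewrite (mulrC (eps (l - 1))).
    move=> X; have sw := (square (l - 1) (l + 1) (eps l)).1 (N2 l) X.
    by rewrite /N sw scalerA -konstM eps2 scale1r.
  have cou := triangular_double_is_courant (omega_nondeg k)
     (pi_inverse k) (symp k).2.
  split=> //; split.
  + by move=> i; apply: hyper_endo_skew.
  + by move=> i e; apply: hyper_endo2.
  + move=> i j /swap[c [c2 prodE sw]] [X a].
    have swf := flat_sharp_swap (omega_nondeg j) (pi_inverse j) c2 sw.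
    rewrite /= /hyper_endo_fun /=; congr (_, _).
      rewrite -/(N i j _) sw linearZ /= !scalerA -!konstM prodE.
      by rewrite [X in _ = konst X *: _](AC (3*1) ((1*3)*(2*4))) /= eps2 mulr1
        (mulrC c).
    rewrite /= !linearZ /= swf !scalerA -!konstM prodE.
    by rewrite !mulrA eps2 mul1r.
  (* For [k = i] the composite is [omega_i^b] itself; otherwise swapping [N k i] into [N i k] lets
     [omega_i^b] cancel [pi_i^#]. *)
  + move=> i; have [d wpw] : exists d, forall X,
        flat (omega i) (N k i X) = konst d *: flat (omega k) X.
      have [->|/swap[c [c2 _ sw]]] := eqVneq k i.
        by exists 1 => X; rewrite /N pi_inverse scale1r.
      by exists c => X; rewrite sw linearZ /= /N (sharpK (omega_nondeg i)).
    exact: deform2_of_closed cou (symp i).2 (symp k).2 wpw.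
- split=> // [i|i X].
    by split=> //; apply: closed_of_deform2 cou (deform2 i).
  apply: (square _ _ _).2 X => X.
  (* The [A]-component of the relation between [S_{i-1}] and [S_{i+1}]; multiplying by [eps (i - 1)]
     removes the sign carried by [S_{i-1}]. *)
  have := congr1 (fun e : Defs.double A => konst (eps (i - 1)) *: e.1)
    (anti _ _ (Z3_neq i) (X, 0)).
  rewrite /= !scalerA -!konstM eps2 scale1r => ->.
  congr (konst _ *: _); rewrite (Z3_prod eps i).
  by rewrite (AC (1*3*1) ((1*2)*(3*5)*4)) /= !eps2 !mul1r.
Qed.
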